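(* For any $\beta\in[0,1)$, Proportional Fairness is $\frac{27}{(1-\beta)^3}$-competitive for $\beta$-robust PSP: for every instance and every choice of the adversary, the total completion time of the resulting schedule is at most $\frac{27}{(1-\beta)^3}$ times the minimum total completion time of any feasible PSP schedule for the instance.
   Context: Polytope Scheduling Problem (PSP): there are jobs $j=1,\dots,n$ with release times $r_j\ge0$ and processing requirements $p_j>0$. A matrix $B=[b_{dj}]\in\mathbb R_{\ge0}^{D\times n}$ defines the downward-closed polytope $\mathcal P=\{y\in\mathbb R^n_{\ge0}: By\le\mathbf 1\}$. A feasible schedule selects at every time $t$ a rate vector $y(t)\in\mathcal P$ with $y_j(t)=0$ unless $j\in J(t)$, where $J(t)$ is the set of jobs released and not completed at $t$; job $j$ completes at the earliest time $C_j$ with $\int_{r_j}^{C_j}y_j(t)\,dt\ge p_j$. Objective: minimize $\sum_jC_j$. $\beta$-robust PSP: at each time $t$ the algorithm chooses $y(t)\in\mathcal P$ for $J(t)$; then an adversary chooses a set $N(t)\subseteq J(t)$ with $|N(t)|\le\beta|J(t)|$, and the processing actually applied is $\hat y_j(t)=y_j(t)$ if $j\notin N(t)$ and $\hat y_j(t)=0$ if $j\in N(t)$; completion times are determined by $\hat y$. Proportional Fairness (PF): at each time $t$, $y(t)$ is an optimal solution of: maximize $\sum_{j\in J(t)}\log y_j$ subject to $\sum_{j\in J(t)}b_{dj}y_j\le1$ for all $d\in[D]$, $y_j\ge0$ (with $y_j=0$ for $j\notin J(t)$). *)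

(* Defs.v *)
From HB Require Import structures.
From mathcomp Require Import all_boot all_order all_algebra.
From mathcomp Require Import all_classical all_reals all_analysis.
Set Implicit Arguments. Unset Strict Implicit. Unset Printing Implicit Defensive.
Import Order.TTheory GRing.Theory Num.Theory.
Local Open Scope classical_set_scope.
Local Open Scope ring_scope.

Section PSP.
Variables (R : realType) (D n : nat).

Definition in_polytope (B : 'M[R]_(D, n)) (y : 'I_n -> R) : Prop :=
  (forall j, 0 <= y j) /\ (forall d : 'I_D, \sum_(j < n) B d j * y j <= 1).

Definition active (r C : 'I_n -> R) (t : R) : {set 'I_n} :=
  [set j | (r j <= t) && (t < C j)].

Definition completion_time (f : R -> R) (rj pj Cj : R) : Prop :=
  rj <= Cj /\
  (pj%:E <= \int[lebesgue_measure]_(x in `[rj, Cj]) (f x)%:E)%E /\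
  (forall t, rj <= t -> t < Cj ->
     (\int[lebesgue_measure]_(x in `[rj, t]) (f x)%:E < pj%:E)%E).

Definition feasible_schedule (B : 'M[R]_(D, n)) (r p : 'I_n -> R)
    (y : R -> 'I_n -> R) (C : 'I_n -> R) : Prop :=
  (forall j, measurable_fun setT (fun t => y t j)) /\
  (forall t, in_polytope B (y t)) /\
  (forall t j, j \notin active r C t -> y t j = 0) /\
  (forall j, completion_time (fun t => y t j) (r j) (p j) (C j)).

(* y is an optimal solution of the Proportional Fairness convex program
   max sum_{j in J} log y_j  s.t. B y <= 1, y >= 0, y_j = 0 for j notin J.
   (Feasible points with some y_j = 0, j in J, have objective -oo.) *)
Definition PF_rates (B : 'M[R]_(D, n)) (J : {set 'I_n}) (y : 'I_n -> R) : Prop :=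
  in_polytope B y /\ (forall j, j \notin J -> y j = 0) /\
  (forall j, j \in J -> 0 < y j) /\
  (forall z : 'I_n -> R, in_polytope B z -> (forall j, j \notin J -> z j = 0) ->
     (forall j, j \in J -> 0 < z j) ->
     \sum_(j in J) ln (z j) <= \sum_(j in J) ln (y j)).

(* processing actually applied when the adversary blocks the jobs of N t *)
Definition applied (y : R -> 'I_n -> R) (N : R -> {set 'I_n}) : R -> 'I_n -> R :=
  fun t j => if j \in N t then 0 else y t j.

Definition robust_PF_run (beta : R) (B : 'M[R]_(D, n)) (r p : 'I_n -> R)
    (y : R -> 'I_n -> R) (N : R -> {set 'I_n}) (C : 'I_n -> R) : Prop :=
  (forall j, measurable_fun setT (fun t => applied y N t j)) /\
  (forall t, PF_rates B (active r C t) (y t)) /\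
  (forall t, N t \subset active r C t) /\
  (forall t, (#|N t|%:R : R) <= beta * #|active r C t|%:R) /\
  (forall j, completion_time (fun t => applied y N t j) (r j) (p j) (C j)).

End PSP.

(* Main.v *)
Require Import Defs.
From HB Require Import structures.
From mathcomp Require Import all_boot all_order all_algebra.
From mathcomp Require Import all_classical all_reals all_analysis.
From mathcomp Require Import measurable_realfun ring lra.
Import Order.TTheory GRing.Theory Num.Theory.
Local Open Scope ring_scope.

(** By the first-order optimality condition, a PF point [y] on the active set
    [J] satisfies [\sum_(j in J) z_j / y_j <= #|J|] for every [z] in the
    polytope.  Put [q_j = y_j / p_j] and let [x] be an [a]-quantile of [q] on
    [J].  The jobs with [q_j <= x] form an [a]-fraction of [J], and any rate
    vector of the polytope processes them, relatively to their sizes, at total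
    rate at most [x #|J|]; of the jobs with [q_j >= x], those not blocked by the
    adversary give PF a total relative rate of at least [b x #|J|], where
    [b = 1 - a - beta].  This is a dual fitting argument: let [alpha_j] be the
    time before [r_j] plus the time job [j] spends among the jobs with
    [q_j <= x], and integrate the comparison over [t >= k s] against the rates
    of the other schedule at time [s].  The result is
    [a \sum_j C_j <= k \sum_j C'_j + (k b)^-1 \sum_j C_j]. *)

Set Implicit Arguments.
Unset Strict Implicit.

(** * Two real inequalities for the perturbation argument *)

(** The bound [ln (1 + u) <= u] at [u = - (x / (1 + x))], where [1 + u = (1 + x)^-1]. *)
Lemma ln1Dx_ge (R : realType) (x : R) : -1 < x -> x / (1 + x) <= ln (1 + x).
Proof.
move=> x_gt; have x1_gt0 : 0 < 1 + x by lra.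
have V_gt0 : 0 < (1 + x)^-1 by rewrite invr_gt0.
have E : (1 + x)^-1 = 1 + - (x / (1 + x)) by field; lra.
have := @le_ln1Dx _ (- (x / (1 + x))).
rewrite -E lnV ?posrE // => H.
have : - ln (1 + x) <= - (x / (1 + x)) by apply: H; lra.
by rewrite lerN2.
Qed.

(** Replaces a limit: a positive [x] is refuted by [e = x / (2 * (x + c))], for which
    [e * c < x]. *)
Lemma le0_of_le_small (R : realFieldType) (x c : R) :
  0 <= c -> (forall e, 0 < e -> e <= 2^-1 -> x <= e * c) -> x <= 0.
Proof.
move=> c_ge0 H; rewrite leNgt; apply/negP => x_gt0.
have d_gt0 : 0 < 2 * (x + c) by lra.
have e_gt0 : 0 < x / (2 * (x + c)) by rewrite divr_gt0.
have e_le : x / (2 * (x + c)) <= 2^-1.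
  by rewrite ler_pdivrMr //; lra.
have := H _ e_gt0 e_le.
rewrite mulrAC ler_pdivlMr // => ?; nra.
Qed.

(** * Optimality condition and uniqueness of PF rates *)

Section ProportionalFairness.
Variables (R : realType) (D n : nat) (B : 'M[R]_(D, n)).
Hypothesis B_ge0 : forall d j, 0 <= B d j.
Implicit Types (J : {set 'I_n}) (y z : 'I_n -> R).

Lemma PF_rates_gt0 J y j : PF_rates B J y -> j \in J -> 0 < y j.
Proof. by move=> [_ [_ [+ _]]]; exact. Qed.

(** A small step from [y] towards [z] cannot raise the sum of logarithms, whose slope in that
    direction is [\sum_(j in J) (z j / y j - 1)]. A quadratic lower bound on [ln] replaces
    differentiation. *)
Lemma PF_variational J y z :
  PF_rates B J y -> in_polytope B z -> \sum_(j in J) z j / y j <= #|J|%:R.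
Proof.
move=> PFy [z_ge0 Bz].
have y_gt0 j : j \in J -> 0 < y j := PF_rates_gt0 PFy (j := j).
have [[y_ge0 By] [y_out [_ y_opt]]] := PFy.
pose v j := z j / y j - 1.
have v_ge j : j \in J -> -1 <= v j.
  by move=> jJ; rewrite /v; have := divr_ge0 (z_ge0 j) (y_ge0 j); lra.
suff : \sum_(j in J) v j <= 0.
  by rewrite /v big_split /= sumr_const mulNrn; lra.
apply: (@le0_of_le_small _ _ (\sum_(j in J) 2 * v j ^+ 2)).
  by apply: sumr_ge0 => j _; nra.
move=> e e_gt0 e_le.
(* Cutting [z] to zero off [J] makes it admissible and, as [B >= 0], keeps it in the polytope;
   [e < 1] keeps [w] positive on [J]. *)
pose w j := (1 - e) * y j + e * (if j \in J then z j else 0).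
have w_poly : in_polytope B w.
  split=> [j | d]; first by rewrite /w; have := y_ge0 j; have := z_ge0 j;
    case: (j \in J) => ? ?; nra.
  have zJ_le : \sum_(j < n) B d j * (if j \in J then z j else 0) <= 1.
    apply: le_trans (Bz d); apply: ler_sum => j _.
    by case: (j \in J) => //; rewrite mulr0 mulr_ge0.
  rewrite (eq_bigr (fun j => (1 - e) * (B d j * y j) +
    e * (B d j * (if j \in J then z j else 0)))); last first.
    by move=> j _; rewrite /w; ring.
  by rewrite big_split /= -!mulr_sumr; have := By d; nra.
have w_out j : j \notin J -> w j = 0.
  by move=> jJ; rewrite /w (negbTE jJ) (y_out _ jJ) !mulr0 addr0.
have w_gt0 j : j \in J -> 0 < w j.
  by move=> jJ; rewrite /w jJ; have := y_gt0 _ jJ; have := z_ge0 j; nra.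
have wE j : j \in J -> ln (w j) = ln (1 + e * v j) + ln (y j).
  move=> jJ; have yj := y_gt0 _ jJ; rewrite -lnM ?posrE //; first last.
    by have := v_ge _ jJ; nra.
  by congr ln; rewrite /w /v jJ; field; lra.
have := y_opt w w_poly w_out w_gt0.
rewrite (eq_bigr _ wE) big_split /= => H.
have {}H : \sum_(j in J) ln (1 + e * v j) <= 0 by lra.
rewrite mulr_sumr -subr_le0 -sumrB.
rewrite -(pmulr_rle0 _ e_gt0) mulr_sumr; apply: le_trans H.
apply: ler_sum => j jJ; have vj := v_ge _ jJ.
have ev : - 2^-1 <= e * v j by nra.
(* For [u = e * v j >= - 2^-1] one has [u / (1 + u) >= u - 2 * u ^+ 2]. *)
apply: le_trans (@ln1Dx_ge R (e * v j) _); last lra.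
rewrite ler_pdivlMr; last lra.
have -> : e * (v j - e * (2 * v j ^+ 2)) * (1 + e * v j) =
  e * v j - (e * v j) ^+ 2 * (1 + 2 * (e * v j)) by ring.
have : 0 <= (e * v j) ^+ 2 * (1 + 2 * (e * v j)) by rewrite mulr_ge0 ?sqr_ge0 //; lra.
lra.
Qed.

(* The variational inequality in both directions gives
   [\sum_(j in J) (x_j + x_j^-1) <= 2 #|J|] for the ratios [x = z / y]. *)
Lemma PF_rates_unique J y z : PF_rates B J y -> PF_rates B J z -> y = z.
Proof.
move=> PFy PFz.
have H1 := PF_variational PFy PFz.1; have H2 := PF_variational PFz PFy.1.
have gap j : j \in J -> (z j - y j) ^+ 2 / (y j * z j) = z j / y j + y j / z j - 2.
  move=> jJ; have := PF_rates_gt0 PFy jJ; have := PF_rates_gt0 PFz jJ => ? ?.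
  by field; rewrite !lt0r_neq0.
have gap_ge0 j : j \in J -> 0 <= (z j - y j) ^+ 2 / (y j * z j).
  move=> jJ; have := PF_rates_gt0 PFy jJ; have := PF_rates_gt0 PFz jJ => ? ?.
  by rewrite divr_ge0 ?sqr_ge0 // mulr_ge0 // ltW.
have S : \sum_(j in J) (z j - y j) ^+ 2 / (y j * z j) == 0.
  rewrite eq_le sumr_ge0 // andbT (eq_bigr _ gap) sumrB big_split /= sumr_const.
  by rewrite -mulr_natr; lra.
apply/funext => j; have [jJ | jJ] := boolP (j \in J); last first.
  by rewrite (PFy.2.1 _ jJ) (PFz.2.1 _ jJ).
move: S; rewrite psumr_eq0 // => /allP/(_ j (mem_index_enum _)).
have := PF_rates_gt0 PFy jJ; have := PF_rates_gt0 PFz jJ => zj yj.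
by rewrite jJ /= mulf_eq0 invr_eq0 (gt_eqF (mulr_gt0 yj zj)) orbF sqrf_eq0 subr_eq0
  => /eqP.
Qed.

End ProportionalFairness.

(** * Quantiles and the comparison at a fixed time *)

(** For nonempty [J], [x] is the least value [q i] with at least [a * #|J|] elements of [J] at or
    below it. Elements tied at [x] count on both sides. *)
Lemma quantile_exists (R : realType) (T : finType) (J : {set T}) (q : T -> R) (a : R) :
  0 < a -> a <= 1 -> exists x,
    a * #|J|%:R <= #|[set j in J | q j <= x]|%:R /\
    (1 - a) * #|J|%:R <= #|[set j in J | x <= q j]|%:R.
Proof.
move=> a_gt0 a_le1.
have [-> | [i0 i0J]] := set_0Vmem J.
  by exists 0; rewrite cards0 !mulr0 !ler0n.
pose low x := [set j in J | q j <= x].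
pose P i := (i \in J) && (a * #|J|%:R <= #|low (q i)|%:R).
have [m mJ m_max] : exists2 m, m \in J & forall j, j \in J -> q j <= q m.
  by case: (@Order.TotalTheory.arg_maxP _ _ _ i0 (mem J) q i0J) => m mJ H; exists m.
have Pm : P m.
  rewrite /P mJ; have -> : low (q m) = J.
    by apply/setP => j; rewrite inE; case: (boolP (j \in J)) => //= /m_max.
  by rewrite ler_piMl.
case: (@Order.TotalTheory.arg_minP _ _ _ m P q Pm) => i /andP[iJ Pi] i_min.
exists (q i); split => //.
pose S := [set j in J | q j < q i].
have SJ : S \subset J by apply/fintype.subsetP => j; rewrite inE => /andP[].
have -> : [set j in J | q i <= q j] = J :\: S.
  by apply/setP => j; rewrite !inE leNgt; case: (j \in J); rewrite ?andbF ?andbT.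
have -> : #|J :\: S|%:R = #|J|%:R - #|S|%:R :> R.
  by rewrite cardsD (finset.setIidPr SJ) natrB // subset_leq_card.
suff : #|S|%:R <= a * #|J|%:R by lra.
have [-> | [k kS]] := set_0Vmem S; first by rewrite cards0 mulr_ge0 // ltW.
(* [S] is the lower set of its largest value [q l]; as [q l < q i], minimality gives
   [#|S| < a * #|J|]. *)
have [l lS l_max] : exists2 l, l \in S & forall j, j \in S -> q j <= q l.
  by case: (@Order.TotalTheory.arg_maxP _ _ _ k (mem S) q kS) => l lS H; exists l.
move: (lS); rewrite inE => /andP[lJ l_lt].
have SE : S = low (q l).
  apply/setP => j; apply/idP/idP => [jS | ].
    by rewrite inE l_max // (fintype.subsetP SJ).
  by rewrite !inE => /andP[-> /le_lt_trans->].
have /negP : ~ P l by move=> /i_min; rewrite leNgt l_lt.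
by rewrite /P lJ SE /= -ltNge => /ltW.
Qed.

Lemma low_ratio_bound (R : realType) (D n : nat) (B : 'M[R]_(D, n))
    (p y z : 'I_n -> R) (J N : {set 'I_n}) (a b beta x : R) :
  (forall d j, 0 <= B d j) -> (forall j, 0 < p j) ->
  0 < b -> a + b + beta <= 1 -> PF_rates B J y -> in_polytope B z ->
  #|N|%:R <= beta * #|J|%:R ->
  (1 - a) * #|J|%:R <= #|[set j in J | (x <= y j / p j)%R]|%:R ->
  \sum_(j in J | y j / p j <= x) z j / p j <=
  b^-1 * \sum_(j in J) (if j \in N then 0 else y j) / p j.
Proof.
move=> B_ge0 p_gt0 b_gt0 abb PFy zP N_le top_ge.
have y_gt0 j : j \in J -> 0 < y j := PF_rates_gt0 PFy (j := j).
have rhs_ge0 : 0 <= \sum_(j in J) (if j \in N then 0 else y j) / p j.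
  apply: sumr_ge0 => j /y_gt0 yj; case: ifP => _; first by rewrite mul0r.
  by rewrite divr_ge0 // ltW.
rewrite mulrC ler_pdivlMr //.
have [x_ge0 | x_lt0] := leP 0 x; last first.
  (* The ratios on [J] are positive, so a negative [x] leaves the left sum empty. *)
  rewrite big_pred0 ?mul0r // => j; apply/negbTE/negP => /andP[jJ yx].
  by have := divr_gt0 (y_gt0 _ jJ) (p_gt0 j); lra.
have J_ge0 : 0 <= #|J|%:R :> R by [].
have low : \sum_(j in J | y j / p j <= x) z j / p j <= x * #|J|%:R.
  apply: le_trans (ler_wpM2l x_ge0 (PF_variational B_ge0 PFy zP)).
  rewrite mulr_sumr big_mkcondr /=; apply: ler_sum => j jJ.
  have yj := y_gt0 _ jJ; have zj := zP.1 j.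
  have zy : 0 <= z j / y j by rewrite divr_ge0 // ltW.
  case: ifP => [yx | _]; last by rewrite mulr_ge0.
  have -> : z j / p j = y j / p j * (z j / y j).
    by field; rewrite !lt0r_neq0.
  by rewrite ler_wpM2r.
set T := [set j in J | x <= y j / p j] in top_ge.
have high : x * (#|T|%:R - #|N|%:R) <=
    \sum_(j in J) (if j \in N then 0 else y j) / p j.
  have card_le : #|T|%:R - #|N|%:R <= #|T :\: N|%:R :> R.
    have : (#|T| <= #|T :\: N| + #|N|)%N.
      by rewrite -(cardsID N T) addnC leq_add2l subset_leq_card // subsetIr.
    by rewrite -(ler_nat R) natrD; lra.
  apply: le_trans (ler_wpM2l x_ge0 card_le) _.
  rewrite mulr_natr -sumr_const [leRHS](big_setID (T :\: N)) /=.
  have -> : J :&: (T :\: N) = T :\: N.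
    by apply/finset.setIidPr/fintype.subsetP => j; rewrite !inE => /and3P[].
  rewrite -[leLHS]addr0 lerD //.
    apply: ler_sum => j; rewrite !inE => /and3P[jN jJ].
    by rewrite (negbTE jN).
  apply: sumr_ge0 => j; rewrite inE => /andP[_ /y_gt0 yj].
  by case: ifP => _; rewrite ?mul0r // divr_ge0 // ltW.
apply: le_trans high; apply: le_trans (ler_wpM2r (ltW b_gt0) low) _.
(* [#|T| - #|N| >= (1 - a - beta) * #|J| >= b * #|J|]. *)
by rewrite -mulrA ler_wpM2l //; nra.
Qed.

(** * Integrating inequalities between finite sums *)

Lemma ge0_integral_lin (R : realType) (I : finType) (S : set R) (c : I -> R)
    (f : I -> R -> R) :
  measurable S -> (forall i, 0 <= c i) -> (forall i x, 0 <= f i x) ->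
  (forall i, measurable_fun setT (f i)) ->
  (\int[lebesgue_measure]_(x in S) (\sum_i c i * f i x)%:E =
   \sum_i (c i)%:E * \int[lebesgue_measure]_(x in S) (f i x)%:E)%E.
Proof.
move=> mS c_ge0 f_ge0 mf.
have mfS i : measurable_fun S (EFin \o f i).
  by apply/measurable_EFinP; apply: measurable_funTS.
under eq_integral do rewrite -sumEFin.
rewrite ge0_integral_sum //.
- apply: eq_bigr => i _; under eq_integral do rewrite EFinM.
  rewrite ge0_integralZl_EFin //; last exact: mfS.
  by move=> x _; rewrite lee_fin.
- move=> i; apply/measurable_EFinP; apply: measurable_funTS.
  by apply: measurable_funM => //; exact: mf.
- by move=> i x _; rewrite lee_fin mulr_ge0.
Qed.

(** Turns a pointwise comparison of rates into one of totals, from a lower bound on each left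
    integral and an upper bound on each right one. *)
Lemma le_integral_lin (R : realType) (I K : finType) (S : set R)
    (c F : I -> R) (f : I -> R -> R) (d G : K -> R) (g : K -> R -> R) :
  measurable S ->
  (forall i, 0 <= c i) -> (forall i x, 0 <= f i x) ->
  (forall i, measurable_fun setT (f i)) ->
  (forall k, 0 <= d k) -> (forall k x, 0 <= g k x) ->
  (forall k, measurable_fun setT (g k)) ->
  (forall x, S x -> \sum_i c i * f i x <= \sum_k d k * g k x) ->
  (forall i, ((F i)%:E <= \int[lebesgue_measure]_(x in S) (f i x)%:E)%E) ->
  (forall k, (\int[lebesgue_measure]_(x in S) (g k x)%:E <= (G k)%:E)%E) ->
  \sum_i c i * F i <= \sum_k d k * G k.
Proof.
move=> mS c_ge0 f_ge0 mf d_ge0 g_ge0 mg fg FI IG.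
have m_lin (L : finType) (e : L -> R) (h : L -> R -> R) :
    (forall l, measurable_fun setT (h l)) ->
    measurable_fun S (EFin \o (fun x => \sum_l e l * h l x)).
  move=> mh; apply/measurable_EFinP; apply: measurable_funTS.
  apply: measurable_sum => l; exact: measurable_funM.
rewrite -lee_fin.
apply: (@le_trans _ _ (\int[lebesgue_measure]_(x in S) (\sum_i c i * f i x)%:E)%E).
  rewrite ge0_integral_lin // -sumEFin; apply: lee_sum => i _.
  by rewrite EFinM lee_wpmul2l // lee_fin.
apply: (@le_trans _ _ (\int[lebesgue_measure]_(x in S) (\sum_k d k * g k x)%:E)%E).
  apply: ge0_le_integral => //; try exact: m_lin.
  by move=> x _; rewrite lee_fin; apply: sumr_ge0 => i _; rewrite mulr_ge0.
rewrite ge0_integral_lin // -sumEFin; apply: lee_sum => k _.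
by rewrite EFinM lee_wpmul2l // lee_fin.
Qed.

(** * Total processing of a job *)

Section Completion.
Variables (R : realType) (f : R -> R) (rj pj Cj M : R).
Hypotheses (rj_ge0 : 0 <= rj) (pj_gt0 : 0 < pj).
Hypotheses (f_ge0 : forall t, 0 <= f t) (mf : measurable_fun setT f).
Hypothesis f_compl : completion_time f rj pj Cj.

Lemma completion_time_gt : rj < Cj.
Proof.
have [rC [pI _]] := f_compl; rewrite lt_neqAle rC andbT; apply/eqP => E.
by move: pI; rewrite -E set_itv1 integral_set1 lee_fin leNgt pj_gt0.
Qed.

Let mfE (S : set R) : measurable_fun S (EFin \o f).
Proof. by apply/measurable_EFinP; apply: measurable_funTS. Qed.

Hypothesis f_le : forall t, f t <= M.

(** Less than [pj] is processed by any [t < Cj], and a rate bounded by [M] adds at most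
    [M * (Cj - t)] afterwards. *)
Lemma completion_time_integral :
  (\int[lebesgue_measure]_(x in `[rj, Cj]) (f x)%:E = pj%:E)%E.
Proof.
have rC := completion_time_gt; have [_ [pI I_lt]] := f_compl.
apply/eqP; rewrite eq_le pI andbT; apply/lee_addgt0Pr => e e_gt0.
have M_ge0 : 0 <= M by apply: le_trans (f_le 0).
(* [M + 1] avoids division by zero; the maximum keeps [rj <= t], where the strict bound applies. *)
pose t := Num.max rj (Cj - e / (M + 1)).
have dlt : 0 < e / (M + 1) by rewrite divr_gt0 //; lra.
have tr : rj <= t by rewrite /t le_max lexx.
have tC : t < Cj by rewrite /t gt_max rC /=; lra.
have tgap : M * (Cj - t) <= e.
  have : Cj - t <= e / (M + 1).
    have : Cj - e / (M + 1) <= t by rewrite /t le_max lexx orbT.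
    lra.
  rewrite ler_pdivlMr; last lra.
  nra.
rewrite (@itv_bndbnd_setU _ _ _ (BRight t)) ?bnd_simp //; last exact: ltW.
rewrite ge0_integral_setU //=; first last.
- apply/disj_setPS => x [] /=; rewrite !in_itv /= => /andP[_ xt] /andP[tx _].
  by move: xt; rewrite leNgt tx.
- by move=> x _; rewrite lee_fin.
- exact: mfE.
apply: leeD; first exact/ltW/I_lt.
apply: (@le_trans _ _ (\int[lebesgue_measure]_(x in `]t, Cj]) (cst M%:E) x)%E).
  by apply: ge0_le_integral => //=; [move=> *; rewrite lee_fin | exact: mfE |
    move=> *; rewrite lee_fin].
rewrite integral_cst //= lebesgue_measure_itv /= lte_fin tC -EFinB -EFinM.
by rewrite lee_fin.
Qed.

Hypothesis f_out : forall t, ~~ ((rj <= t) && (t < Cj)) -> f t = 0.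

Lemma completion_time_integral_ge0 :
  (\int[lebesgue_measure]_(x in `[0%R, +oo[) (f x)%:E = pj%:E)%E.
Proof.
rewrite -completion_time_integral [RHS]integral_mkcond [LHS]integral_mkcond.
apply: eq_integral => x _; rewrite !patchE !mem_setE !in_itv /= andbT.
case: (boolP ((rj <= x) && (x < Cj))) => [/andP[rx xC] | /f_out ->].
  by rewrite rx (ltW xC) (le_trans rj_ge0 rx).
by rewrite !if_same.
Qed.

(** The indicator makes the sum over jobs, after division by [pj], count those not completed at
    [u]. *)
Lemma completion_time_integral_from (u : R) : 0 <= u ->
  (\int[lebesgue_measure]_(x in `[u, +oo[) (f x)%:E <= (pj * (u < Cj)%R%:R)%R%:E)%E.
Proof.
move=> u_ge0; case: ltP => [uC | Cu].
  rewrite mulr1 -completion_time_integral_ge0; apply: ge0_subset_integral => //=.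
  - exact: mfE.
  - by move=> x _; rewrite lee_fin.
  - by move=> x /=; rewrite !in_itv /= !andbT; apply: le_trans.
rewrite mulr0 integral0_eq // => x /=; rewrite in_itv /= andbT => ux.
by rewrite f_out // ltNge (le_trans Cu ux) andbF.
Qed.

End Completion.

(** * Measurability of the active set *)

Section ActiveSets.
Local Open Scope classical_set_scope.
Variables (R : realType) (n : nat) (r C : 'I_n -> R).

(** The active set takes finitely many values, each on a finite intersection of intervals [[r j, C
    j[] and complements of such. *)
Lemma measurable_active (P : pred {set 'I_n}) :
  measurable [set t | P (active r C t)].
Proof.
have -> : [set t | P (active r C t)] =
    \bigcup_(J in [set J | P J]) [set t | active r C t = J].
  apply/seteqP; split=> [t /= Pt | t [J /= PJ JE]].
    by exists (active r C t).
  by rewrite JE.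
apply: fin_bigcup_measurable; first exact: finite_finset.
move=> J _.
have -> : [set t | active r C t = J] =
    \bigcap_(j in [set: 'I_n]) [set t | (j \in active r C t) = (j \in J)].
  apply/seteqP; split=> [t /= <- j _ // | t /= E].
  by apply/setP => j; apply: E.
apply: fin_bigcap_measurable; first exact: finite_finset.
move=> j _.
have -> : [set t | (j \in active r C t) = (j \in J)] =
    if j \in J then `[r j, C j[%classic else ~` `[r j, C j[%classic.
  apply/seteqP; split=> t; rewrite /= inE; case: (j \in J);
    rewrite /= in_itv //=; first by move=> ->.
  by move=> /negP/negbTE.
by case: ifP => _; [|apply: measurableC]; exact: measurable_itv.
Qed.

End ActiveSets.

(** * Job counts and completion times through indicators *)

Lemma sum_mem_card (R : pzSemiRingType) (T : finType) (A : {set T}) :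
  \sum_j (j \in A)%:R = #|A|%:R :> R.
Proof.
by rewrite -sumr_const [RHS]big_mkcond; apply: eq_bigr => j _; case: (j \in A).
Qed.

Lemma integral_indic_itvco (R : realType) (c : R) : 0 <= c ->
  (\int[lebesgue_measure]_(x in `[0%R, +oo[) (\1_(`[0%R, c[%classic : set R) x)%:E
   = c%:E)%E.
Proof.
move=> c_ge0; rewrite integral_indic // setIidl; last first.
  by move=> x /=; rewrite !in_itv /= andbT => /andP[].
have [-> | c_gt0] := eqVneq c 0; first by rewrite set_itvco0 measure0.
by rewrite /= lebesgue_measure_itv /= lte_fin lt_neqAle eq_sym c_gt0 c_ge0 sube0.
Qed.

(** * Dual fitting along a PF run *)

Section Run.
Variables (R : realType) (D n : nat) (beta : R) (B : 'M[R]_(D, n)).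
Variables (r p : 'I_n -> R) (y : R -> 'I_n -> R) (N : R -> {set 'I_n}).
Variable C : 'I_n -> R.
Hypotheses (B_ge0 : forall d j, 0 <= B d j) (r_ge0 : forall j, 0 <= r j).
Hypotheses (p_gt0 : forall j, 0 < p j) (run : robust_PF_run beta B r p y N C).

Let mapp : forall j, measurable_fun setT (fun t => applied y N t j) := run.1.
Let PFy : forall t, PF_rates B (active r C t) (y t) := run.2.1.
Let N_le : forall t, #|N t|%:R <= beta * #|active r C t|%:R := run.2.2.2.1.
Let compl j : completion_time (fun t => applied y N t j) (r j) (p j) (C j) :=
  run.2.2.2.2 j.

Let rC j : r j < C j.
Proof. exact: completion_time_gt (p_gt0 j) (compl j). Qed.

Let y_ge0 t j : 0 <= y t j.
Proof. exact: (PFy t).1.1. Qed.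

Let app_ge0 j t : 0 <= applied y N t j.
Proof. by rewrite /applied; case: ifP. Qed.

(** Job [j] is active at [r j], so [z j / y (r j) j] is one term of a variational sum that is at
    most [n]. This supplies the rate bound [M] for both schedules. *)
Lemma polytope_bounded z j : in_polytope B z -> z j <= n%:R * y (r j) j.
Proof.
move=> zP; have jJ : j \in active r C (r j) by rewrite inE lexx rC.
rewrite -ler_pdivrMr; last exact: PF_rates_gt0 (PFy _) jJ.
apply: (@le_trans _ _ #|active r C (r j)|%:R); last first.
  by rewrite ler_nat -[leqRHS]card_ord max_card.
apply: le_trans (PF_variational B_ge0 (PFy (r j)) zP).
rewrite (bigD1 j) //= lerDl; apply: sumr_ge0 => i _.
by rewrite divr_ge0 // zP.1.
Qed.

(* Measurability is assumed for the applied rates only; that of the PF rates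
   themselves comes from this factorization through the active set. *)
Lemma PF_rates_of_active :
  exists Y : {set 'I_n} -> 'I_n -> R, forall t, y t = Y (active r C t).
Proof.
suff /choice[Y YP] : forall S, exists z, forall t, active r C t = S -> y t = z.
  by exists Y => t; apply: YP.
move=> S; have [[t tS] | noS] := pselect (exists t, active r C t = S).
  exists (y t) => t' t'S; apply: (PF_rates_unique B_ge0 (PFy t')).
  by rewrite t'S -tS.
by exists (fun=> 0) => t tS; case: noS; exists t.
Qed.

Lemma integral_applied_from (u : R) j : 0 <= u ->
  (\int[lebesgue_measure]_(x in `[u, +oo[) (applied y N x j)%:E
   <= (p j * (u < C j)%R%:R)%R%:E)%E.
Proof.
move=> u_ge0.
apply: (completion_time_integral_from (r_ge0 j) (p_gt0 j) (app_ge0 j) (mapp j)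
  (compl j) (M := n%:R * y (r j) j)) => //.
- move=> t; rewrite /applied; case: ifP => _; last exact: polytope_bounded (PFy t).1.
  by rewrite mulr_ge0.
- move=> t tJ; rewrite /applied; case: ifP => // _.
  by apply: (PFy t).2.1; rewrite inE.
Qed.

(** Times before [u] contribute at most [u] to [alpha j]. For the rest, [low_ratio_bound] integrated
    over [t >= u] gives [b^-1] times the relative work PF applies after [u], at most 1 per job not
    completed at [u]. *)
Lemma dual_bound (a b : R) :
  0 < a -> 0 < b -> a + b + beta <= 1 -> a <= 1 ->
  exists alpha : 'I_n -> R,
    [/\ forall j, 0 <= alpha j,
        a * \sum_j C j <= \sum_j alpha j &
        forall z (u : R), 0 <= u -> in_polytope B z ->
          (forall j, u < r j -> z j = 0) ->
          \sum_j z j / p j * (alpha j - u) <= b^-1 * \sum_j (u < C j)%R%:R].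
Proof.
move=> a_gt0 b_gt0 abb a_le1.
have [Y yE] := PF_rates_of_active.
(* One quantile per active set, not per time, makes [L j] measurable. *)
have /choice[x xP] := fun S : {set 'I_n} =>
  @quantile_exists _ _ S (fun j => Y S j / p j) a a_gt0 a_le1.
pose low (S : {set 'I_n}) := [set j in S | Y S j / p j <= x S].
pose L j : set R := [set t | j \in low (active r C t)]%classic.
pose E j : set R := (`]-oo, r j[ `|` L j)%classic.
have mL j : measurable (L j) := measurable_active r C (fun S => j \in low S).
have mE j : measurable (E j) by exact: measurableU.
have LJ j t : L j t -> r j <= t < C j by rewrite /L /= !inE => /andP[].
pose mu := @lebesgue_measure R.
(* Finiteness of this measure lets [fine] in [alpha] preserve its value. *)
have EC j : (mu (E j `&` `[0%R, +oo[)%classic <= (C j)%:E)%E.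
  have -> : (C j)%:E = mu `[0, C j]%classic.
    rewrite /mu lebesgue_measure_itv /= lte_fin (le_lt_trans (r_ge0 j) (rC j)).
    by rewrite sube0.
  apply: le_measure; rewrite ?inE //.
    exact: measurableI (mE j) (measurable_itv _).
  move=> t [Et]; rewrite /= !in_itv /= andbT => -> /=.
  case: Et => [|/LJ/andP[_ /ltW] //]; rewrite /= in_itv /= => tr.
  exact: ltW (lt_trans tr (rC j)).
pose alpha j := fine (mu (E j `&` `[0%R, +oo[)%classic).
have alphaE j : (alpha j)%:E = mu (E j `&` `[0%R, +oo[)%classic.
  by rewrite fineK // ge0_fin_numE // (le_lt_trans (EC j)) // ltry.
exists alpha; split=> [j | | z u u_ge0 zP z_out]; first exact: fine_ge0.
  rewrite mulr_sumr -[leRHS](eq_bigr _ (fun j _ => mul1r (alpha j))).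
  apply: (@le_integral_lin R 'I_n 'I_n `[0%R, +oo[%classic (fun=> a) C
    (fun j => \1_(`[0%R, C j[%classic : set R)) (fun=> 1) alpha
    (fun j => \1_(E j))) => //.
  - by move=> _; exact: ltW.
  (* Jobs with [t < C j] are unreleased or active; the sets [E j] keep all of the former and at
     least a fraction [a] of the latter. *)
  - move=> t /=; rewrite in_itv /= andbT => t_ge0.
    have EJ j : \1_(`[0, C j[%classic : set R) t =
        (t < r j)%R%:R + (j \in active r C t)%:R :> R.
      rewrite indicE mem_setE in_itv /= t_ge0 inE /=.
      case: (ltP t (r j)) => [tr | _]; last by rewrite add0r.
      by rewrite (lt_trans tr (rC j)) addr0.
    have EL j : \1_(E j) t = (t < r j)%R%:R + (j \in low (active r C t))%:R :> R.
      rewrite indicE /E in_setU mem_setE in_itv /=.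
      have -> : (t \in L j) = (j \in low (active r C t)).
        by apply/idP/idP; rewrite inE.
      rewrite !inE; case: (ltP t (r j)) => _; first by rewrite addr0.
      by rewrite add0r.
    rewrite -mulr_sumr (eq_bigr _ (fun j _ => EJ j)).
    rewrite [leRHS](eq_bigr _ (fun j _ => etrans (mul1r _) (EL j))).
    rewrite !big_split /= !sum_mem_card mulrDr lerD //; last exact: (xP _).1.
    by rewrite ler_piMl // sumr_ge0.
  - by move=> j; rewrite integral_indic_itvco // (le_trans (r_ge0 j)) // ltW.
  - by move=> j; rewrite integral_indic ?alphaE //; exact: mE.
(* If [u < r j], the time before [r j] may push [alpha j - u] above the measure of [L j] after [u];
   there [z j = 0], so 0 serves instead. *)
pose F j := if r j <= u then alpha j - u else 0.
have -> : \sum_j z j / p j * (alpha j - u) = \sum_j z j / p j * F j.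
  apply: eq_bigr => j _; rewrite /F; case: leP => // /z_out ->.
  by rewrite !mul0r.
have -> : b^-1 * \sum_j (u < C j)%R%:R =
    \sum_j b^-1 / p j * (p j * (u < C j)%R%:R).
  by rewrite mulr_sumr; apply: eq_bigr => j _; rewrite mulrA divfK // gt_eqF.
apply: (@le_integral_lin R 'I_n 'I_n `[u, +oo[%classic _ _ (fun j => \1_(L j))
  _ _ (fun j t => applied y N t j)) => //.
- by move=> j; rewrite divr_ge0 ?zP.1 // ltW.
- by move=> j; rewrite divr_ge0 // ?invr_ge0 ltW.
- move=> t _; set J := active r C t.
  have := @low_ratio_bound R D n B p (y t) z J (N t) a b beta (x J) B_ge0 p_gt0
    b_gt0 abb (PFy t) zP (N_le t).
  rewrite {1}yE => /(_ (xP _).2) H.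
  have -> : \sum_j z j / p j * \1_(L j) t =
      \sum_(j in J | y t j / p j <= x J) z j / p j.
    rewrite [RHS]big_mkcond; apply: eq_bigr => j _; rewrite indicE.
    have -> : (t \in L j) = (j \in J) && (y t j / p j <= x J).
      have -> : (t \in L j) = (j \in low J) by apply/idP/idP; rewrite inE.
      by rewrite inE yE.
    by case: ifP => _; rewrite ?mulr1 ?mulr0.
  apply: le_trans H _; rewrite mulr_sumr big_mkcond /=.
  apply: ler_sum => j _; rewrite /applied.
  case: ifP => _; first by rewrite mulrAC mulrA.
  by rewrite mulr_ge0 ?app_ge0 // divr_ge0 // ?invr_ge0 ltW.
- move=> j; rewrite integral_indic //; last exact: mL.
  rewrite /F; case: (leP (r j) u) => // ru.
  rewrite EFinB leeBlDr // alphaE -/mu.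
  have -> : u%:E = mu `[0, u]%classic.
    rewrite /mu lebesgue_measure_itv /= lte_fin.
    by move: u_ge0; rewrite le_eqVlt => /predU1P[<- | ->]; rewrite ?ltxx ?sube0.
  have mLu : measurable (L j `&` `[u, +oo[)%classic.
    exact: measurableI (mL j) (measurable_itv _).
  (* As [r j <= u], the part of [E j] from [u] on lies in [L j]. *)
  apply: (@le_trans _ _ (mu (L j `&` `[u, +oo[ `|` `[0, u])%classic)); last first.
    exact: measureU2.
  apply: le_measure; rewrite ?inE //.
  - exact: measurableI (mE j) (measurable_itv _).
  - exact: measurableU.
  move=> t [Et]; rewrite /= !in_itv /= !andbT => t_ge0.
  have [ut | tu] := leP u t; last by right; rewrite t_ge0 ltW.
  left; split=> //; case: Et => //; rewrite /= in_itv /= => tr.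
  by have := lt_le_trans tr (le_trans ru ut); rewrite ltxx.
- by move=> j; exact: integral_applied_from.
Qed.

(** The dual inequality at [u = k * s], [z = y' s] is integrated over [s >= 0]: the rate of [j] in
    [y'] has integral [p j], a job running at [s] has [k * s <= k * C' j], and [k * s < C j] lasts
    for time [C j / k]. *)
Lemma competitive_bound (a b k : R) (y' : R -> 'I_n -> R) (C' : 'I_n -> R) :
  0 < a -> 0 < b -> a + b + beta <= 1 -> a <= 1 -> 1 <= k ->
  feasible_schedule B r p y' C' ->
  a * \sum_j C j <= k * \sum_j C' j + (k * b)^-1 * \sum_j C j.
Proof.
move=> a_gt0 b_gt0 abb a_le1 k_ge1 [my' [y'P [y'_out compl']]].
have k_gt0 : 0 < k by lra.
have [alpha [alpha_ge0 alphaC alpha_dual]] := dual_bound a_gt0 b_gt0 abb a_le1.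
apply: le_trans alphaC _.
have y'_ge0 j t : 0 <= y' t j := (y'P t).1 j.
have Iy' j : (\int[lebesgue_measure]_(x in `[0%R, +oo[) (y' x j)%:E = (p j)%:E)%E.
  apply: (completion_time_integral_ge0 (r_ge0 j) (p_gt0 j) (y'_ge0 j) (my' j)
    (compl' j) (M := n%:R * y (r j) j)).
  - by move=> t; exact: polytope_bounded.
  - by move=> t tJ; apply: y'_out; rewrite inE.
have C_ge0 j : 0 <= C j by rewrite (le_trans (r_ge0 j)) // ltW.
have C'_ge0 j : 0 <= C' j := le_trans (r_ge0 j) (compl' j).1.
have p_neq0 j : p j != 0 by rewrite gt_eqF.
pose d (l : 'I_n + 'I_n) := match l with
  inl j => k * C' j / p j | inr j => b^-1 end.
pose G (l : 'I_n + 'I_n) := match l with inl j => p j | inr j => C j / k end.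
pose g (l : 'I_n + 'I_n) : R -> R := match l with
  inl j => fun s => y' s j | inr j => \1_(`[0%R, C j / k[%classic : set R) end.
have -> : \sum_j alpha j = \sum_j alpha j / p j * p j.
  by apply: eq_bigr => j _; rewrite divfK.
have -> : k * (\sum_j C' j) + (k * b)^-1 * (\sum_j C j) = \sum_l d l * G l.
  rewrite big_sumType /= !mulr_sumr; congr (_ + _); apply: eq_bigr => j _.
    by rewrite divfK.
  by rewrite invfM mulrC [k^-1 * _]mulrC mulrCA.
apply: (@le_integral_lin R 'I_n ('I_n + 'I_n)%type `[0%R, +oo[%classic _ _
  (fun j s => y' s j) d G g) => //.
- by move=> j; rewrite divr_ge0 // ltW.
- by case=> j /=; rewrite ?invr_ge0 ?divr_ge0 ?mulr_ge0 // ltW.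
- by case=> j s /=.
- by case=> j /=; [exact: my' | exact: measurable_indic].
- move=> s /=; rewrite in_itv /= andbT => s_ge0.
  (* By [1 <= k], a job unreleased at [k * s] is unreleased at [s], as [alpha_dual] requires of
     [y' s]. *)
  have ks_ge : s <= k * s by rewrite ler_peMl.
  have ks_out j : k * s < r j -> y' s j = 0.
    move=> ksr; apply: y'_out; rewrite inE negb_and -ltNge.
    by rewrite (le_lt_trans ks_ge ksr).
  have := alpha_dual _ _ (mulr_ge0 (ltW k_gt0) s_ge0) (y'P s) ks_out.
  rewrite big_sumType /= -mulr_sumr.
  have -> : \sum_j \1_(`[0%R, C j / k[%classic : set R) s =
      \sum_j (k * s < C j)%R%:R :> R.
    apply: eq_bigr => j _; rewrite indicE mem_setE in_itv /= s_ge0 /=.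
    by rewrite ltr_pdivlMr // mulrC.
  set rhs := b^-1 * _ => H.
  apply: le_trans (lerD (lexx _) H); rewrite -big_split /=.
  apply: ler_sum => j _.
  have -> : alpha j / p j * y' s j = y' s j / p j * alpha j.
    by ring.
  have -> : k * C' j / p j * y' s j = y' s j / p j * (k * C' j) by ring.
  rewrite -mulrDr; have [sC' | C's] := ltP s (C' j).
    have kss : k * s <= k * C' j by rewrite ler_wpM2l // ltW.
    apply: ler_wpM2l; first exact: divr_ge0 (y'_ge0 j s) (ltW (p_gt0 j)).
    by lra.
  by rewrite y'_out ?mul0r // inE negb_and -!leNgt C's orbT.
- by move=> j; rewrite Iy'.
- case=> j /=; first by rewrite Iy'.
  by rewrite integral_indic_itvco // divr_ge0 // ltW.
Qed.

End Run.

(** * Choice of the constants *)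

Unset Implicit Arguments.

Theorem mainTheorem9 (R : realType) (D n : nat) (beta : R) (B : 'M[R]_(D, n))
    (r p : 'I_n -> R) :
  0 <= beta -> beta < 1 ->
  (forall d j, 0 <= B d j) -> (forall j, 0 <= r j) -> (forall j, 0 < p j) ->
  forall (y : R -> 'I_n -> R) (N : R -> {set 'I_n}) (C : 'I_n -> R),
    robust_PF_run beta B r p y N C ->
    forall (y' : R -> 'I_n -> R) (C' : 'I_n -> R),
      feasible_schedule B r p y' C' ->
      \sum_(j < n) C j <= 27 / (1 - beta) ^+ 3 * \sum_(j < n) C' j.
Proof.
move=> beta_ge0 beta_lt1 B_ge0 r_ge0 p_gt0 y N C run y' C' feas.
pose g := 1 - beta.
(* For fixed [a] and [b] the best [k] is [2 / (a * b)], with ratio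
   [4 / (a ^+ 2 * b)]; on [a + b = g] this is least at [a = 2 g / 3]. *)
have g_gt0 : 0 < g by rewrite /g; lra.
have g_le1 : g <= 1 by rewrite /g; lra.
have k_ge1 : 1 <= 9 / g ^+ 2 by rewrite ler_pdivlMr ?exprn_gt0 //; nra.
have a_gt0 : 0 < 2 / 3 * g by lra.
have b_gt0 : 0 < g / 3 by lra.
have abb : 2 / 3 * g + g / 3 + beta <= 1 by rewrite /g; lra.
have a_le1 : 2 / 3 * g <= 1 by lra.
have := competitive_bound B_ge0 r_ge0 p_gt0 run a_gt0 b_gt0 abb a_le1 k_ge1 feas.
(* Absorbing this term leaves the coefficient [a - g / 3 = g / 3] on the left, and [9 / g ^+ 2]
   divided by it is [27 / g ^+ 3]. *)
have -> : (9 / g ^+ 2 * (g / 3))^-1 = g / 3 by field; lra.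
move=> H; rewrite -/g.
have -> : 27 / g ^+ 3 * \sum_j C' j = (9 / g ^+ 2 * \sum_j C' j) / (g / 3).
  by field; lra.
by rewrite ler_pdivlMr //; lra.
Qed.
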